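(* Consider a network with excited nodes $\mathcal B$ ($|\mathcal B|=n_B$), measured nodes $\mathcal C$ ($|\mathcal C|=n_C$), known edges $E^0$ and unknown edges $E^\Delta$, with $|E^\Delta|=n_Bn_C$. If the network is generically decoupled-identifiable, then there is at least one assignation $\sigma=(\sigma_B,\sigma_C)$, $\sigma_B:E^\Delta\to\mathcal B$, $\sigma_C:E^\Delta\to\mathcal C$ (the map $\sigma:E^\Delta\to\mathcal B\times\mathcal C$ is not required to be bijective), such that: (a) $n_C$ unknown edges $\alpha$ are assigned to each excitation $b\in\mathcal B$ (i.e. $|\sigma_B^{-1}(b)|=n_C$); (b) $n_B$ unknown edges $\alpha$ are assigned to each measurement $c\in\mathcal C$ (i.e. $|\sigma_C^{-1}(c)|=n_B$); (c) $\sigma$ is connected; (d) for each excitation $b$, there are $n_C$ vertex-disjoint paths between the edges assigned to $b$ and the measurements $\mathcal C$; (e) for each measurement $c$, there are $n_B$ vertex-disjoint paths between the edges assigned to $c$ and the excitations $\mathcal B$. If there is exactly one assignation $\sigma$ satisfying (a)–(e), then the network is generically decoupled-identifiable.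
   Context: Network. There are $n$ nodes, a set $\mathcal B$ of $n_B$ excited nodes and a set $\mathcal C$ of $n_C$ measured nodes. $B\in\{0,1\}^{n\times n_B}$ is the selection matrix of $\mathcal B$ (each column has exactly one 1, marking an excited node; full column rank); $C\in\{0,1\}^{n_C\times n}$ is the selection matrix of $\mathcal C$ (each row has exactly one 1, marking a measured node; full row rank). The topology is a directed graph on the nodes with edge set $E$, the disjoint union of known edges $E^0$ and unknown edges $E^\Delta$; the edge from $j$ (start node) to $i$ (end node) corresponds to the matrix entry $(i,j)$. A single frequency is considered, so transfer functions are complex numbers. A network matrix is $G=G^0+G^\Delta\in\mathbb C^{n\times n}$, with $G^0$ supported on $E^0$ and $G^\Delta$ supported on $E^\Delta$. Well-posedness is assumed throughout: only $G$ with $I-G$ invertible are considered; $T(G)=(I-G)^{-1}$. Decoupled identifiability. For $G=G^0+G^\Delta$ and $G'=G^0+G'^\Delta$ (same zero entries and same known entries), the network is decoupled-identifiable at $(G,G')$ if for all $\Delta\in\mathbb C^{n\times n}$ supported on $E^\Delta$: $C\,T(G)\,\Delta\,T(G')\,B=0\Rightarrow\Delta=0$. The network is generically decoupled-identifiable if this holds for almost all $(G,G')$, i.e. for almost all values of the known entries $G^0$ (shared by $G$ and $G'$), the unknown entries $G^\Delta$ and the unknown entries $G'^\Delta$; ''almost all'' means all except possibly those lying on a lower-dimensional set (a set of dimension lower than that of the parameter space, for instance one contained in the zero set of a nonzero polynomial). Paths and connectivity. Paths are directed paths, possibly of length zero (a single vertex). A group of paths is vertex-disjoint if no two of them contain a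 common vertex. The conditions are read in the decoupled graph: two copies of the graph (left copy carrying the excitations, right copy carrying the measurements), with each unknown edge $\alpha=(j\to i)$ additionally giving an edge from the left copy of $j$ to the right copy of $i$. An assignation $\sigma=(\sigma_B,\sigma_C)$ is connected if for each unknown edge $\alpha$ there is a path from its assigned excitation $\sigma_B(\alpha)$ (left copy) to its assigned measurement $\sigma_C(\alpha)$ (right copy) in which $\alpha$ is included; equivalently, in the original graph there is a path from $\sigma_B(\alpha)$ to the start node of $\alpha$ and a path from the end node of $\alpha$ to $\sigma_C(\alpha)$. Vertex-disjoint paths between the $n_C$ edges assigned to $b$ and $\mathcal C$ are $n_C$ vertex-disjoint paths (in a copy of the original graph), one starting at the end node of each edge in $\sigma_B^{-1}(b)$, ending at nodes of $\mathcal C$. Vertex-disjoint paths between the $n_B$ edges assigned to $c$ and $\mathcal B$ are $n_B$ vertex-disjoint paths, starting at nodes of $\mathcal B$, one ending at the start node of each edge in $\sigma_C^{-1}(c)$. *)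

(* Defs.v *)
From mathcomp Require Import all_boot all_order all_algebra.
From mathcomp Require Import complex.
From mathcomp Require Import reals.
From mathcomp Require Import mpoly.

Set Implicit Arguments.
Unset Strict Implicit.
Unset Printing Implicit Defensive.

Import GRing.Theory.
Local Open Scope ring_scope.

(** * Graphs *)

(* [(j, i)] is the edge from [j] to [i]; it carries the matrix entry [(i, j)]. *)
Notation edge n := ('I_n * 'I_n)%type.

Definition start_node (n : nat) (a : edge n) : 'I_n := a.1.
Definition end_node (n : nat) (a : edge n) : 'I_n := a.2.

Definition edge_rel (n : nat) (E : {set edge n}) : rel 'I_n :=
  fun x y => (x, y) \in E.

(* [p] is the full list of vertices of the path, both endpoints included;
   [p = [:: x]] is the path of length zero. *)
Definition dipath (T : eqType) (e : rel T) (x y : T) (p : seq T) : bool :=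
  if p is z :: q then [&& z == x, path e z q, last z q == y & uniq p]
  else false.

(* [inl] is the left copy (excitations), [inr] the right copy (measurements). *)
Definition decoupled_rel (n : nat) (E ED : {set edge n}) :
    rel ('I_n + 'I_n)%type :=
  fun u v => match u, v with
  | inl x, inl y => (x, y) \in E
  | inr x, inr y => (x, y) \in E
  | inl j, inr i => (j, i) \in ED
  | inr _, inl _ => false
  end.

(** * Decoupled identifiability *)

Definition supported (F : nmodType) (n : nat) (E : {set edge n})
    (M : 'M[F]_n) : Prop :=
  forall i j : 'I_n, (j, i) \notin E -> M i j = 0.

Definition excitation_mx (F : pzRingType) (n : nat) (Bs : {set 'I_n}) :
    'M[F]_(n, #|Bs|) :=
  \matrix_(i < n, k < #|Bs|) (i == enum_val k)%:R.

Definition measurement_mx (F : pzRingType) (n : nat) (Cs : {set 'I_n}) :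
    'M[F]_(#|Cs|, n) :=
  \matrix_(k < #|Cs|, j < n) (enum_val k == j)%:R.

Definition well_posed (F : comUnitRingType) (n : nat) (G : 'M[F]_n) : bool :=
  1%:M - G \in unitmx.

Definition transfer (F : comUnitRingType) (n : nat) (G : 'M[F]_n) : 'M[F]_n :=
  invmx (1%:M - G).

Definition decoupled_identifiable_at (F : comUnitRingType) (n : nat)
    (Bs Cs : {set 'I_n}) (ED : {set edge n}) (G G' : 'M[F]_n) : Prop :=
  forall D : 'M[F]_n, supported ED D ->
    measurement_mx F Cs *m transfer G *m D *m transfer G' *m excitation_mx F Bs
      = 0 ->
    D = 0.

(* Over an infinite field F, a nonzero polynomial vanishes on S exactly when the
   Zariski closure of S has lower dimension than the affine space [F^I]. *)
Definition lower_dimensional (F : comNzRingType) (I : finType)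
    (S : (I -> F) -> Prop) : Prop :=
  exists2 p : {mpoly F[#|I|]}, p != 0 &
    forall x : I -> F, S x -> p.@[fun k => x (enum_val k)] = 0.

Definition edges_mx (F : nmodType) (n : nat) (E : {set edge n})
    (x : {a : edge n | a \in E} -> F) : 'M[F]_n :=
  \matrix_(i < n, j < n)
    if (insub (j, i) : option {a : edge n | a \in E}) is Some a then x a else 0.

(* The free entries of a pair (G, G'): those of G^0, which G and G' share, then
   those of G^Delta, then those of G'^Delta. *)
Definition parameter (n : nat) (E0 ED : {set edge n}) : finType :=
  ({a : edge n | a \in E0} +
     ({a : edge n | a \in ED} + {a : edge n | a \in ED}))%type.

Definition network_G (F : nmodType) (n : nat) (E0 ED : {set edge n})
    (x : parameter E0 ED -> F) : 'M[F]_n :=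
  edges_mx (fun a => x (inl a)) + edges_mx (fun a => x (inr (inl a))).

Definition network_G' (F : nmodType) (n : nat) (E0 ED : {set edge n})
    (x : parameter E0 ED -> F) : 'M[F]_n :=
  edges_mx (fun a => x (inl a)) + edges_mx (fun a => x (inr (inr a))).

Definition generically_decoupled_identifiable (F : comUnitRingType) (n : nat)
    (Bs Cs : {set 'I_n}) (E0 ED : {set edge n}) : Prop :=
  lower_dimensional (fun x : parameter E0 ED -> F =>
    let G := network_G x in
    let G' := network_G' x in
    [/\ well_posed G, well_posed G' &
        ~ decoupled_identifiable_at Bs Cs ED G G']).

(** * Assignations *)

Definition assignation (n : nat) (Bs Cs : {set 'I_n}) (ED : {set edge n}) :
    Type :=
  ({ffun {a : edge n | a \in ED} -> {b : 'I_n | b \in Bs}} *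
   {ffun {a : edge n | a \in ED} -> {c : 'I_n | c \in Cs}})%type.

Section Assignations.

Variables (n : nat) (Bs Cs : {set 'I_n}) (E0 ED : {set edge n}).
Implicit Type s : assignation Bs Cs ED.

Let E := E0 :|: ED.

Definition assigned_to_excitation s (b : {b : 'I_n | b \in Bs}) :
    {set {a : edge n | a \in ED}} := [set a | s.1 a == b].

Definition assigned_to_measurement s (c : {c : 'I_n | c \in Cs}) :
    {set {a : edge n | a \in ED}} := [set a | s.2 a == c].

(* [zip p (behead p)] lists the edges traversed by [p]. *)
Definition connected_assignation s : Prop :=
  forall a : {a : edge n | a \in ED},
    exists2 p : seq ('I_n + 'I_n),
      dipath (decoupled_rel E ED) (inl (val (s.1 a))) (inr (val (s.2 a))) p &
      (inl (start_node (val a)), inr (end_node (val a))) \in zip p (behead p).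

Definition vertex_disjoint (I : finType) (A : {set I}) (P : I -> seq 'I_n) :
    Prop :=
  {in A &, forall a a', a != a' -> [disjoint P a & P a']}.

Definition disjoint_paths_to_measurements
    (A : {set {a : edge n | a \in ED}}) : Prop :=
  exists P : {a : edge n | a \in ED} -> seq 'I_n,
    {in A, forall a, exists2 c : 'I_n, c \in Cs &
       dipath (edge_rel E) (end_node (val a)) c (P a)} /\
    vertex_disjoint A P.

Definition disjoint_paths_from_excitations
    (A : {set {a : edge n | a \in ED}}) : Prop :=
  exists P : {a : edge n | a \in ED} -> seq 'I_n,
    {in A, forall a, exists2 b : 'I_n, b \in Bs &
       dipath (edge_rel E) b (start_node (val a)) (P a)} /\
    vertex_disjoint A P.

Definition admissible s : Prop :=
  [/\ forall b, #|assigned_to_excitation s b| = #|Cs|,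
      forall c, #|assigned_to_measurement s c| = #|Bs|,
      connected_assignation s,
      forall b, disjoint_paths_to_measurements (assigned_to_excitation s b) &
      forall c, disjoint_paths_from_excitations (assigned_to_measurement s c)].

End Assignations.

(* Main.v *)
Require Import Defs.
From mathcomp Require Import all_boot all_order all_algebra.
From mathcomp Require Import perm complex.
From mathcomp Require Import reals.
From mathcomp Require Import mpoly.
Local Open Scope ring_scope.

Set Implicit Arguments.
Unset Strict Implicit.
Unset Printing Implicit Defensive.

Import GRing.Theory Num.Theory.

(** The measured response [C T(G) D T(G') B] is linear in the unknown entries
    [D_a] of [D], with coefficient [T(G)_(c, end a) * T(G')_(start a, b)] in row
    [(c, b)] and column [a].  As there are as many unknown edges as rows, the
    network is identifiable at [(G, G')] exactly when the determinant of this
    square array is nonzero ([identifiable_free_columns]).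

    Distributing, in each column [a], the second factor over the excitations
    expands the determinant as a sum over all maps [s] from unknown edges to
    excitations ([det_row_product]).  The term of [s] is, up to sign, the
    product of the entries [T(G')_(start a, s a)] and of the minors of [T(G)]
    with rows [Cs] and columns the end nodes of the edges sent to a given
    excitation.  Exchanging the two factors gives the same expansion over maps
    from unknown edges to measurements.

    A minor of a transfer matrix is controlled by vertex-disjoint paths.  It is
    nonzero together with the determinant of the bordered matrix built from
    [1 - G] and the two selection matrices ([det_bordered_eq0]).  A permutation
    contributing to the Leibniz expansion of the latter draws disjoint paths
    through the graph ([linking_of_det]); conversely, disjoint paths give a
    network for which that determinant is nonzero ([det_of_linking]), hence a
    minor that is generically nonzero ([generic_minor]).  Entries of the
    transfer matrix are minors of size one, so that the same argument covers
    connectedness.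

    Admissibility of [(sB, sC)] splits into a condition on [sB] and a condition
    on [sC] ([admissible_split]), and each says that the corresponding term of
    one of the two expansions is generically nonzero.  If the network is
    generically identifiable, both expansions have a nonzero term at some
    point, and the two terms together form an admissible assignation.  If the
    admissible assignation [(sB, sC)] is unique, no other [sB'] can replace
    [sB]; all other terms of the first expansion then vanish at every
    well-posed point, and the remaining one is generically nonzero.  Each
    factor of that term is a nonzero polynomial in the free entries, and these
    polynomials form an integral domain, so the known entries shared by [G] and
    [G'] cannot make the factors cancel one another. *)

(** * Nonzero multivariate polynomials have a point of nonvanishing *)

Lemma poly_nonroot (F : numDomainType) (p : {poly F}) :
  p != 0 -> exists t, p.[t] != 0.
Proof.
move=> p0.
pose rs : seq F := [seq k%:R | k <- iota 0 (size p)].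
have rs_uniq : uniq rs.
  by rewrite map_inj_uniq ?iota_uniq // => i j /eqP; rewrite eqr_nat => /eqP.
have : ~~ all (root p) rs.
  apply/negP => h; have := max_poly_roots p0 h rs_uniq.
  by rewrite size_map size_iota ltnn.
by case/allPn => t _ rt; exists t.
Qed.

(** A multi-exponent is determined by its last entry and the others, so no two
    monomials are merged by [muni] and every coefficient can be read off. *)
Lemma muni_neq0 (F : nzRingType) (n : nat) (p : {mpoly F[n.+1]}) :
  p != 0 -> muni p != 0.
Proof.
apply: contra => /eqP p0; apply/eqP/mpolyP => m; rewrite mcoeff0.
pose cut (m' : 'X_{1..n.+1}) : 'X_{1..n} :=
  [multinom (m' (widen_ord (leqnSn n) i)) | i < n].
have cut_inj (m' : 'X_{1..n.+1}) : m' ord_max = m ord_max -> cut m' = cut m -> m' = m.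
  move=> hmax /mnmP hcut; apply/mnmP => i.
  case: (unliftP ord_max i) => [j ->|-> //].
  have -> : lift ord_max j = widen_ord (leqnSn n) j.
    by apply: val_inj; rewrite /= /bump leqNgt ltn_ord.
  by have := hcut j; rewrite !mnmE.
have : ((muni p)`_(m ord_max))@_(cut m) = 0 by rewrite p0 coef0 mcoeff0.
rewrite muniE coef_sum raddf_sum /=.
under eq_bigr => m' _ do rewrite coefZ coefXn mulr_natr raddfMn /= mcoeffZ mcoeffX.
have off (m' : 'X_{1..n.+1}) : m' != m ->
    (p@_m' * (cut m' == cut m)%:R) *+ (m ord_max == m' ord_max) = 0.
  move=> m'm; case: (m ord_max =P m' ord_max) => [e|_]; last by rewrite mulr0n.
  case: (cut m' =P cut m) => [e'|_]; last by rewrite mulr0 mul0rn.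
  by rewrite (cut_inj m') ?eqxx // in m'm.
have [inm|ninm] := boolP (m \in msupp p); last first.
  by move=> _; apply/eqP; rewrite mcoeff_eq0.
rewrite (bigD1_seq m) //= ?msupp_uniq // !eqxx mulr1 mulr1n.
by rewrite big1 ?addr0.
Qed.

Lemma meval_muni (F : comNzRingType) (n : nat) (p : {mpoly F[n.+1]})
    (v : 'I_n.+1 -> F) :
  p.@[v] =
  (map_poly (meval (fun i => v (widen_ord (leqnSn n) i))) (muni p)).[v ord_max].
Proof.
rewrite mevalE muniE raddf_sum /= -horner_evalE raddf_sum /=.
apply: eq_bigr => m _; rewrite horner_evalE map_polyZ /= hornerZ map_polyXn hornerXn.
rewrite mevalZ mevalX -mulrA big_ord_recr /=; congr (_ * (_ * _)).
by apply: eq_bigr => i _; rewrite mnmE.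
Qed.

(** The successive variables are specialised one at a time: the leading
    coefficient in the last variable is a nonzero polynomial in the others. *)
Lemma mpoly_nonroot (F : numDomainType) (n : nat) (p : {mpoly F[n]}) :
  p != 0 -> exists v : 'I_n -> F, p.@[v] != 0.
Proof.
elim: n p => [|n IHn] p p0.
  exists (fun=> 0); move: p0; apply: contra => /eqP.
  rewrite mevalE => h; apply/eqP/mpolyP => m; rewrite mcoeff0.
  have m0 m' : m' = m :> 'X_{1..0} by apply/mnmP; case.
  have [inm|ninm] := boolP (m \in msupp p); last by apply/eqP; rewrite mcoeff_eq0.
  move: h; rewrite (bigD1_seq m) ?msupp_uniq //= [X in _ + X]big1 => [|m'].
    by rewrite big_ord0 mulr1 addr0.
  by rewrite (m0 m') eqxx.
have := muni_neq0 p0; rewrite -lead_coef_eq0 => /IHn [v' v'0].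
have /poly_nonroot [t t0] : map_poly (meval v') (muni p) != 0.
  apply: contraNneq v'0 => /(congr1 (fun q : {poly F} => q`_(size (muni p)).-1)).
  by rewrite coef_map coef0 => /eqP.
pose v i := if unlift ord_max i is Some j then v' j else t.
exists v; rewrite meval_muni /v unlift_none /=.
rewrite (eq_map_poly (g := meval v')) // => q; apply: meval_eq => i.
have -> : widen_ord (leqnSn n) i = lift ord_max i.
  by apply: val_inj; rewrite /= /bump leqNgt ltn_ord.
by rewrite liftK.
Qed.

(** * Polynomial functions and generic properties *)

Definition polynomial_fun (F : comNzRingType) (I : finType)
    (f : (I -> F) -> F) : Prop :=
  exists q : {mpoly F[#|I|]}, forall x, q.@[fun k => x (enum_val k)] = f x.

Section PolynomialFun.

Variables (F : comNzRingType) (I : finType).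
Implicit Types f g : (I -> F) -> F.

Lemma polynomial_fun_ext f g : f =1 g -> polynomial_fun f -> polynomial_fun g.
Proof. by move=> fg [q qf]; exists q => x; rewrite qf fg. Qed.

Lemma polynomial_fun_const c : polynomial_fun (fun _ : I -> F => c).
Proof. by exists c%:MP => x; rewrite mevalC. Qed.

Lemma polynomial_fun_coord i : polynomial_fun (fun x : I -> F => x i).
Proof. by exists 'X_(enum_rank i) => x; rewrite mevalXU enum_rankK. Qed.

Lemma polynomial_funD f g :
  polynomial_fun f -> polynomial_fun g -> polynomial_fun (fun x => f x + g x).
Proof. by move=> [p pf] [q qg]; exists (p + q) => x; rewrite mevalD pf qg. Qed.

Lemma polynomial_funM f g :
  polynomial_fun f -> polynomial_fun g -> polynomial_fun (fun x => f x * g x).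
Proof. by move=> [p pf] [q qg]; exists (p * q) => x; rewrite mevalM pf qg. Qed.

Lemma polynomial_funN f : polynomial_fun f -> polynomial_fun (fun x => - f x).
Proof. by move=> [p pf]; exists (- p) => x; rewrite mevalN pf. Qed.

Lemma polynomial_fun_sum (J : finType) (f : J -> (I -> F) -> F) :
  (forall j, polynomial_fun (f j)) ->
  polynomial_fun (fun x => \sum_j f j x).
Proof.
move=> pf; elim: (index_enum J) => [|j r IHr].
  by apply: polynomial_fun_ext (polynomial_fun_const 0) => x; rewrite big_nil.
by apply: polynomial_fun_ext (polynomial_funD (pf j) IHr) => x; rewrite big_cons.
Qed.

Lemma polynomial_fun_prod (J : finType) (f : J -> (I -> F) -> F) :
  (forall j, polynomial_fun (f j)) ->
  polynomial_fun (fun x => \prod_j f j x).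
Proof.
move=> pf; elim: (index_enum J) => [|j r IHr].
  by apply: polynomial_fun_ext (polynomial_fun_const 1) => x; rewrite big_nil.
by apply: polynomial_fun_ext (polynomial_funM (pf j) IHr) => x; rewrite big_cons.
Qed.

Lemma polynomial_fun_det (n : nat) (M : (I -> F) -> 'M[F]_n) :
  (forall i j, polynomial_fun (fun x => M x i j)) ->
  polynomial_fun (fun x => \det (M x)).
Proof.
move=> pM; apply: polynomial_fun_sum => s; apply: polynomial_funM.
  exact: polynomial_fun_const.
exact: polynomial_fun_prod.
Qed.

End PolynomialFun.

(** Kept as a property of the good points rather than of the exceptional set:
    finite conjunctions then only multiply the witnessing polynomials. *)
Definition generically (F : comNzRingType) (I : finType)
    (Q : (I -> F) -> Prop) : Prop :=
  exists2 q : {mpoly F[#|I|]}, q != 0 &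
    forall x, q.@[fun k => x (enum_val k)] != 0 -> Q x.

Lemma generically_imply (F : comNzRingType) (I : finType)
    (Q Q' : (I -> F) -> Prop) :
  (forall x, Q x -> Q' x) -> generically Q -> generically Q'.
Proof. by move=> QQ' [q q0 qQ]; exists q => // x /qQ /QQ'. Qed.

Lemma generically_neq0 (F : comNzRingType) (I : finType) (f : (I -> F) -> F) x0 :
  polynomial_fun f -> f x0 != 0 -> generically (fun x => f x != 0).
Proof.
move=> [q qf] f0; exists q => [|x]; last by rewrite qf.
by apply: contraNneq f0 => q0; rewrite -qf q0 meval0.
Qed.

Lemma generically_and (F : idomainType) (I : finType) (Q Q' : (I -> F) -> Prop) :
  generically Q -> generically Q' -> generically (fun x => Q x /\ Q' x).
Proof.
move=> [q q0 qQ] [q' q'0 qQ']; exists (q * q'); first by rewrite mulf_neq0.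
by move=> x; rewrite mevalM mulf_eq0 negb_or => /andP[/qQ ? /qQ' ?].
Qed.

Lemma generically_all (F : idomainType) (I J : finType)
    (Q : J -> (I -> F) -> Prop) :
  (forall j, generically (Q j)) -> generically (fun x => forall j, Q j x).
Proof.
move=> gQ.
suff: generically (fun x => forall j, j \in index_enum J -> Q j x).
  by apply: generically_imply => x Qx j; apply: Qx; rewrite mem_index_enum.
elim: (index_enum J) => [|j r IHr].
  by exists 1 => //; rewrite oner_neq0.
apply: generically_imply (generically_and (gQ j) IHr) => x [Qj Qr] i.
by rewrite in_cons => /predU1P[->|/Qr].
Qed.

Lemma generically_ex (F : numDomainType) (I : finType) (Q : (I -> F) -> Prop) :
  generically Q -> exists x, Q x.
Proof.
move=> [q /mpoly_nonroot[v v0] qQ]; exists (fun i => v (enum_rank i)).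
by apply: qQ; rewrite (meval_eq (v2 := v)) // => k; rewrite enum_valK.
Qed.

Lemma lower_dimensional_generically (F : comNzRingType) (I : finType)
    (S : (I -> F) -> Prop) :
  lower_dimensional S <-> generically (fun x => ~ S x).
Proof.
split=> [[q q0 qS]|[q q0 qS]]; exists q => // x.
  by move=> qx /qS qx0; rewrite qx0 eqxx in qx.
by move=> Sx; apply: contraTeq isT => /qS /(_ Sx).
Qed.

(** * Linearly independent columns *)

(** The array is indexed by finite types so that the same notion serves the full
    coefficient array, its blocks and the minors of the transfer matrix, whose
    rows and columns have no canonical numbering. *)
Definition free_columns (F : fieldType) (I J : finType) (f : I -> J -> F)
    (S : {set J}) : Prop :=
  forall v : J -> F,
    (forall i, \sum_(j in S) f i j * v j = 0) -> {in S, forall j, v j = 0}.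

Lemma enumeration (T : finType) (A : {set T}) (k : nat) :
  #|A| = k -> exists2 e : 'I_k -> T, injective e & [set e i | i : 'I_k] = A.
Proof.
move=> <-; exists enum_val; first exact: enum_val_inj.
apply/setP => a; apply/imsetP/idP => [[i _ ->]|aA]; first exact: enum_valP.
by exists (enum_rank_in aA a); rewrite ?enum_rankK_in.
Qed.

Section FreeColumns.

Variables (F : fieldType).

Lemma free_columnsP (I J : finType) (f : I -> J -> F) (S : {set J}) (k : nat)
    (r : 'I_k -> I) (e : 'I_k -> J) :
    bijective r -> injective e -> [set e i | i : 'I_k] = S ->
  reflect (free_columns f S) (\det (\matrix_(i, j < k) f (r i) (e j)) != 0).
Proof.
move=> r_bij e_inj <-; set M := \matrix_(i, j) _.
have sumE v i : \sum_(j in [set e i | i : 'I_k]) f (r i) j * v j =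
    \sum_j M i j * v (e j).
  rewrite big_imset /=; last by move=> ? ? _ _ /e_inj.
  by apply: eq_bigr => j _; rewrite mxE.
apply: (iffP idP) => [M0 v v0 _ /imsetP[j _ ->]|free_f].
  pose u : 'rV_k := \row_j v (e j).
  suff : u == 0 by move=> /eqP/rowP/(_ j); rewrite !mxE.
  apply: contraNT M0 => u0; rewrite -det_tr; apply/det0P; exists u => //.
  apply/rowP => i; rewrite !mxE -[RHS](v0 (r i)) sumE; apply: eq_bigr => l _.
  by rewrite !mxE mulrC.
case: r_bij => r' rK r'K; rewrite -det_tr; apply/det0P => -[u u0 uM].
pose v j := \sum_l u 0 l * (e l == j)%:R.
have ve l : v (e l) = u 0 l.
  rewrite /v (bigD1 l) //= eqxx mulr1 big1 ?addr0 // => l' l'l.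
  by rewrite (inj_eq e_inj) (negbTE l'l) mulr0.
case/negP: u0; apply/eqP/rowP => l; rewrite mxE -ve.
apply: free_f; last by rewrite imset_f.
move=> i0; rewrite -[i0]r'K sumE; move/rowP: uM => /(_ (r' i0)); rewrite !mxE => uM.
by rewrite -[RHS]uM; apply: eq_bigr => j _; rewrite ve !mxE mulrC.
Qed.

(** The rank of the columns in [S], which equals [#|S|], is at most the number
    of rows. *)
Lemma free_columns_card (I J : finType) (f : I -> J -> F) (S : {set J}) :
  free_columns f S -> (#|S| <= #|I|)%N.
Proof.
move=> free_f.
pose M : 'M_(#|S|, #|I|) := \matrix_(j, i) f (enum_val i) (enum_val j).
suff : row_free M by move/eqP <-; apply: rank_leq_col.
apply: inj_row_free => u uM; apply/rowP => l; rewrite mxE.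
pose v j := \sum_l u 0 l * (enum_val l == j)%:R.
have ve l' : v (enum_val l') = u 0 l'.
  rewrite /v (bigD1 l') //= eqxx mulr1 big1 ?addr0 // => l2 ll.
  by rewrite (inj_eq enum_val_inj) (negbTE ll) mulr0.
rewrite -ve; apply: free_f (enum_valP l) => i.
rewrite big_enum_val /=; move/rowP: uM => /(_ (enum_rank i)); rewrite !mxE => uM.
by rewrite -[RHS]uM; apply: eq_bigr => j _; rewrite ve !mxE enum_rankK mulrC.
Qed.

End FreeColumns.

(** * Column-wise expansion of a determinant of products *)

Section ColumnwiseLaplace.

Variables (F : fieldType) (A B C : finType).
Variables (X : C -> A -> F) (Y : B -> A -> F).
Implicit Type s : {ffun A -> B}.

Definition fiber s b : {set A} := [set a | s a == b].

Definition row_product (cb : C * B) (a : A) : F := X cb.1 a * Y cb.2 a.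

(** Once the rows are sorted by excitation, this array is block diagonal: the
    block of [b] has the columns [fiber s b] of [X]. *)
Definition fiber_block s (cb : C * B) (a : A) : F :=
  X cb.1 a * (s a == cb.2)%:R.

(** Column [a] of the array is the sum over [b] of [Y b a] times the column of
    [X] placed in the rows of [b]; the expansion is multilinearity of the
    determinant in its columns. *)
Lemma det_row_product (m : nat) (r : 'I_m -> C * B) (e : 'I_m -> A) :
    bijective e ->
  \det (\matrix_(i, j < m) row_product (r i) (e j)) =
  \sum_s \det (\matrix_(i, j < m) fiber_block s (r i) (e j)) * \prod_a Y (s a) a.
Proof.
move=> e_bij; have [e' eK e'K] := e_bij.
have reindexE (H : 'I_m -> A -> F) : \prod_j H j (e j) = \prod_a H (e' a) a.
  rewrite [RHS](reindex e) /=; last exact: onW_bij.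
  by apply: eq_bigr => j _; rewrite eK.
under [RHS]eq_bigr => s _ do rewrite -det_tr big_distrl /=.
rewrite exchange_big -det_tr; apply: eq_bigr => /= p _.
under [RHS]eq_bigr => s _ do rewrite -mulrA.
rewrite -big_distrr /=; congr (_ * _).
pose t (i : 'I_m) : 'I_m := (p : {perm 'I_m}) i.
transitivity (\prod_a \sum_b X (r (t (e' a))).1 a * (b == (r (t (e' a))).2)%:R * Y b a).
  rewrite -(reindexE (fun j a => \sum_b X (r (t j)).1 a * (b == (r (t j)).2)%:R * Y b a)).
  apply: eq_bigr => j _; rewrite !mxE (bigD1 (r (t j)).2) //= eqxx mulr1.
  by rewrite big1 ?addr0 // => b /negbTE ->; rewrite mulr0 mul0r.
rewrite bigA_distr_bigA; apply: eq_bigr => s _.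
rewrite big_split /=; congr (_ * _).
rewrite -(reindexE (fun j a => X (r (t j)).1 a * (s a == (r (t j)).2)%:R)).
by apply: eq_bigr => j _; rewrite !mxE.
Qed.

(** Comparing with independence of the columns of each block avoids computing
    the block-diagonal determinant, and its sign, up to reordering. *)
Lemma free_fiber_block s :
  free_columns (fiber_block s) setT <-> forall b, free_columns X (fiber s b).
Proof.
have fiberE (v : A -> F) c b :
    \sum_(a in setT) fiber_block s (c, b) a * v a = \sum_(a in fiber s b) X c a * v a.
  rewrite [RHS]big_mkcond; apply: eq_big => a; rewrite ?inE //= => _.
  by rewrite /fiber_block /=; case: (s a == b); rewrite ?mulr1 // mulr0 mul0r.
split=> [free_s b v v0 a | free_X v v0 a _].
  rewrite inE => /eqP sa.
  pose w a' := if s a' == b then v a' else 0.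
  have <- : w a = v a by rewrite /w sa eqxx.
  apply: free_s; rewrite ?inE // => -[c b']; rewrite fiberE.
  have [<-|b'b] := eqVneq b b'.
    rewrite -[RHS](v0 c); apply: eq_bigr => a' ; rewrite inE /w => /eqP ->.
    by rewrite eqxx.
  apply: big1 => a'; rewrite inE /w => /eqP ->.
  by rewrite eq_sym (negbTE b'b) mulr0.
apply: (free_X (s a)); last by rewrite inE.
by move=> c; rewrite -fiberE v0.
Qed.

Lemma sum_card_fiber s : (\sum_b #|fiber s b|)%N = #|A|.
Proof.
rewrite -sum1_card (partition_big s xpredT) //=; apply: eq_bigr => b _.
by rewrite -sum1_card; apply: eq_bigl => a; rewrite inE.
Qed.

(** Independence bounds each fiber by [#|C|]; the fibers add up to
    [#|B| * #|C|], so every bound is attained. *)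
Lemma card_fiber s : #|A| = (#|B| * #|C|)%N ->
  (forall b, free_columns X (fiber s b)) -> forall b, #|fiber s b| = #|C|.
Proof.
move=> cardA free_X.
have /leqif_sum le_sum : forall b, true ->
    (#|fiber s b| <= #|C| ?= iff (#|fiber s b| == #|C|))%N.
  by move=> b _; split; first exact: free_columns_card (free_X b).
have := le_sum.2.
by rewrite sum_card_fiber cardA sum_nat_const eqxx => /esym/forallP h b; apply/eqP/h.
Qed.

Hypothesis cardA : #|A| = (#|B| * #|C|)%N.

Definition nonzero_term s : Prop :=
  (forall a, Y (s a) a != 0) /\ forall b, free_columns X (fiber s b).

Let card_rows : #|A| = #|{: C * B}|.
Proof. by rewrite card_prod mulnC. Qed.

Let row i : C * B := enum_val (cast_ord card_rows i).

Let row_bij : bijective row.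
Proof.
exists (fun cb => cast_ord (esym card_rows) (enum_rank cb)) => i.
  by rewrite /row enum_valK cast_ordK.
by rewrite /row cast_ordKV enum_rankK.
Qed.

Let col_image : [set enum_val i | i : 'I_#|A|] = [set: A].
Proof.
apply/setP => a; rewrite inE; apply/imsetP; exists (enum_rank a) => //.
by rewrite enum_rankK.
Qed.

Let freeP (f : C * B -> A -> F) : reflect (free_columns f setT)
  (\det (\matrix_(i, j < #|A|) f (row i) (enum_val j)) != 0) :=
  free_columnsP f row_bij enum_val_inj col_image.

(** Independence is decidable, being the nonvanishing of a determinant. *)
Lemma free_row_product_stable :
  ~ ~ free_columns row_product setT -> free_columns row_product setT.
Proof. by move=> nn; case: (freeP row_product) => // /nn. Qed.

Lemma free_row_product_term :
  free_columns row_product setT -> exists s, nonzero_term s.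
Proof.
move=> /freeP; rewrite det_row_product; last exact: enum_val_bij.
have [/existsP[s /andP[Ns /forallP Ys]] _|none] := boolP [exists s,
    (\det (\matrix_(i, j < #|A|) fiber_block s (row i) (enum_val j)) != 0) &&
    [forall a, Y (s a) a != 0]].
  by exists s; split=> //; apply/free_fiber_block/freeP.
rewrite big1 ?eqxx // => s _; apply/eqP; rewrite mulf_eq0.
have := none; rewrite negb_exists => /forallP/(_ s).
rewrite negb_and negbK => /orP[-> //|]; rewrite negb_forall => /existsP[a].
by rewrite negbK => /eqP Ya; rewrite (bigD1 a) //= Ya mul0r eqxx orbT.
Qed.

Lemma free_row_product_unique s :
  nonzero_term s -> (forall s', nonzero_term s' -> s' = s) ->
  free_columns row_product setT.
Proof.
move=> [Ys free_s] s_uniq; apply/freeP.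
rewrite det_row_product; last exact: enum_val_bij.
rewrite (bigD1 s) //= [X in _ + X]big1 => [|s' s's].
  rewrite addr0 mulf_neq0 //; last by apply/prodf_neq0 => a _.
  by apply/freeP/free_fiber_block.
apply/eqP; apply: contraNT s's; rewrite mulf_eq0 negb_or => /andP[Ns' Ys'].
apply/eqP/s_uniq; split; first by move/prodf_neq0: Ys' => Ys' a; apply: Ys'.
by apply/free_fiber_block/freeP.
Qed.

End ColumnwiseLaplace.

(** * Minors of the transfer matrix and vertex-disjoint paths *)

(** The entries of this matrix are affine in those of [G], unlike the minors of
    the transfer matrix. *)
Definition bordered (F : pzRingType) (n k : nat) (G : 'M[F]_n)
    (src dst : 'I_k -> 'I_n) : 'M[F]_(n + k) :=
  block_mx (1%:M - G) (\matrix_(i, l) (i == src l)%:R)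
           (\matrix_(l, j) (dst l == j)%:R) 0.

(** Block elimination of [1 - G] leaves minus the minor as Schur complement. *)
Lemma det_bordered_eq0 (F : fieldType) (n k : nat) (G : 'M[F]_n)
    (src dst : 'I_k -> 'I_n) : well_posed G ->
  (\det (bordered G src dst) == 0) =
  (\det (\matrix_(l, m) transfer G (dst l) (src m)) == 0).
Proof.
move=> wG.
pose Pin : 'M[F]_(n, k) := \matrix_(i, l) (i == src l)%:R.
pose Pout : 'M[F]_(k, n) := \matrix_(l, j) (dst l == j)%:R.
have minorE : \matrix_(l, m) transfer G (dst l) (src m) = Pout *m transfer G *m Pin.
  apply/matrixP => l m; rewrite !mxE (bigD1 (src m)) //= big1 => [|i /negbTE im].
    rewrite !mxE (bigD1 (dst l)) //= !mxE !eqxx mul1r mulr1 big1 ?addr0 // => i.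
    by rewrite eq_sym mxE => /negbTE ->; rewrite mul0r.
  by rewrite !mxE im mulr0.
have -> : bordered G src dst =
    block_mx 1%:M 0 (Pout *m transfer G) 1%:M *m
    block_mx (1%:M - G) Pin 0 (- (Pout *m transfer G *m Pin)).
  rewrite mulmx_block !mul1mx !mul0mx !addr0 subrr.
  by rewrite -[Pout *m _ *m (_ - _)]mulmxA mulVmx // mulmx1.
rewrite det_mulmx det_lblock det_ublock !det1 !mul1r minorE.
rewrite -[- (_ *m _)]scaleN1r detZ.
rewrite !mulf_eq0 signr_eq0 /=.
by move: wG; rewrite /well_posed unitmxE unitfE => /negbTE ->.
Qed.

Section Linking.

Variables (n k : nat) (E : {set edge n}) (src dst : 'I_k -> 'I_n).

Definition linking (P : 'I_k -> seq 'I_n) (t : 'I_k -> 'I_k) : Prop :=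
  (forall m, dipath (edge_rel E) (src m) (dst (t m)) (P m)) /\
  (forall m m', m != m' -> [disjoint P m & P m']).

Lemma dipath_mkseq (T : eqType) (e : rel T) (f : nat -> T) (N : nat) :
    (forall i, (i < N)%N -> e (f i) (f i.+1)) ->
    (forall i j, (i <= N)%N -> (j <= N)%N -> f i = f j -> i = j) ->
  dipath e (f 0%N) (f N) (mkseq f N.+1).
Proof.
move=> f_step f_inj.
have f_uniq : uniq (mkseq f N.+1).
  by apply/mkseq_uniqP => i j; rewrite !inE !ltnS; apply: f_inj.
rewrite /dipath; move: f_uniq; rewrite /mkseq /= eqxx => -> /=; rewrite andbT.
apply/andP; split; last first.
  by rewrite last_map (last_nth 0%N) size_iota -[0%N :: _]/(iota 0 N.+1) nth_iota.
apply/(pathP (f 0%N)) => i; rewrite size_map size_iota => iN.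
rewrite (nth_map 0%N) ?size_iota // nth_iota // add1n.
case: i iN => [|i] iN /=; first exact: f_step.
rewrite (nth_map 0%N) ?size_iota 1?ltnW // nth_iota 1?ltnW // add1n.
exact: f_step.
Qed.

Lemma dipathP (T : eqType) (e : rel T) (x y : T) (p : seq T) :
  dipath e x y p ->
  exists N (f : nat -> T),
    [/\ f 0%N = x, f N = y, forall i, (i < N)%N -> e (f i) (f i.+1),
        forall i j, (i <= N)%N -> (j <= N)%N -> f i = f j -> i = j &
        p = mkseq f N.+1].
Proof.
case: p => //= z q /and4P[/eqP zx /(pathP x) path_q /eqP lq /andP[zq uq]].
exists (size q), (nth x (z :: q)); split=> //.
- by rewrite -lq (last_nth x).
- move=> i j iN jN /eqP; rewrite nth_uniq ?ltnS //= ?zq ?uq //.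
  by move/eqP.
- by rewrite -[LHS](mkseq_nth x).
Qed.

(** Take a permutation with a nonzero product in the Leibniz expansion, and let
    [u] be its inverse.  A node [j] that [u] moves to another node [i] satisfies
    [(j, i) \in E]; the border index [m] is sent to [src m], and a node sent to a
    border index [l] is [dst l].  The orbit of a border index up to its first
    return to the border is thus a path from a source to a destination, and
    different pieces of orbits are disjoint. *)
Lemma linking_of_det (F : fieldType) (G : 'M[F]_n) :
  supported E G -> \det (bordered G src dst) != 0 -> exists P t, linking P t.
Proof.
move=> supG det0.
have [s s0] : exists s : 'S_(n + k), \prod_j bordered G src dst j (s j) != 0.
  apply/existsP; apply: contraNT det0; rewrite negb_exists => /forallP none.
  rewrite /determinant big1 // => s _.
  by move: (none s); rewrite negbK => /eqP ->; rewrite mulr0.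
pose u z := (s^-1)%g z.
have u_inj : injective u by apply: perm_inj.
have iter_inj d : injective (iter d u).
  by elim: d => [|d IHd] y z //= /u_inj /IHd.
have entry z : bordered G src dst (u z) z != 0.
  by move/prodf_neq0: s0 => /(_ (u z) isT); rewrite /u permKV.
have ur m : u (rshift n m) = lshift k (src m).
  have := entry (rshift n m); case: (split_ordP (u (rshift n m))) => l ->.
    by rewrite block_mxEur mxE; case: (l =P src m) => [-> //|_]; rewrite eqxx.
  by rewrite block_mxEdr mxE eqxx.
have ulr j m : u (lshift k j) = rshift n m -> j = dst m.
  move=> uj; have := entry (lshift k j); rewrite uj block_mxEdl mxE.
  by case: (dst m =P j) => [-> //|_]; rewrite eqxx.
have ull j i : u (lshift k j) = lshift k i -> i != j -> (j, i) \in E.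
  move=> uj ij; have := entry (lshift k j); rewrite uj block_mxEul !mxE.
  by rewrite (negbTE ij) sub0r oppr_eq0; apply: contraNT => /supG ->; rewrite eqxx.
pose out (z : 'I_(n + k)) := if split z is inr _ then true else false.
have outr m : out (rshift n m) by rewrite /out (unsplitK (inr m)).
have outl j : out (lshift k j) = false by rewrite /out (unsplitK (inl j)).
(* [w] collects the last position of the path, the border index reached after
   it, and the successive nodes. *)
have orbits m : exists w : (nat * 'I_k) * (nat -> 'I_n),
    (forall i, (i <= w.1.1)%N -> iter i.+1 u (rshift n m) = lshift k (w.2 i)) /\
    iter w.1.1.+2 u (rshift n m) = rshift n w.1.2.
  have [d /andP[d0 outd] d_min] : {d | (0 < d)%N && out (iter d u (rshift n m)) &
      forall i, (0 < i)%N && out (iter i u (rshift n m)) -> (d <= i)%N}.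
    have ex_d : exists d, (0 < d)%N && out (iter d u (rshift n m)).
      exists (order u (rshift n m)).
      by rewrite order_gt0 iter_order // outr.
    by exists (ex_minn ex_d); case: ex_minnP.
  case: d d0 outd d_min => [//|[|N]] _; first by rewrite /= ur outl.
  case: (split_ordP (iter N.+2 u (rshift n m))) => [j ->|l itl _ d_min].
    by rewrite outl.
  pose f i := if split (iter i.+1 u (rshift n m)) is inl j then j else src m.
  exists ((N, l), f); split=> //= i iN; rewrite /f -[u (iter _ _ _)]/(iter i.+1 _ _).
  case: (split_ordP (iter i.+1 u (rshift n m))) => [j -> //|l' itl'].
  by have := d_min i.+1; rewrite itl' outr => /(_ isT); rewrite ltnS ltnNge iN.
have [w w_path] := fin_all_exists orbits.
have w_orbit m :
    (forall i, (i <= (w m).1.1)%N ->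
       iter i.+1 u (rshift n m) = lshift k ((w m).2 i)) /\
    iter (w m).1.1.+2 u (rshift n m) = rshift n (w m).1.2 by exact: w_path.
(* Two pieces meeting at positions [i <= j] can be rewound by [i.+1] steps to
   the border; [j - i] is then a return time below the first one, hence 0. *)
have f_inj m m' i j : (i <= (w m).1.1)%N -> (j <= (w m').1.1)%N ->
    (w m).2 i = (w m').2 j -> m = m' /\ i = j.
  wlog ij : m m' i j / (i <= j)%N.
    move=> base; have [ij|/ltnW ji] := leqP i j; first exact: base.
    by move=> hi hj /esym /(base m' m j i ji hj hi) [-> ->].
  move=> hi hj fE.
  have : iter i.+1 u (rshift n m) = iter j.+1 u (rshift n m').
    by rewrite (w_orbit m).1 // (w_orbit m').1 // fE.
  rewrite -(subnKC ij) -addSn iterD => /iter_inj.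
  case: (j - i)%N (leq_subr i j) => [_ /= /rshift_inj -> |d dj]; first by rewrite addn0.
  rewrite (w_orbit m').1; last exact: ltnW (leq_trans dj hj).
  by move=> /(congr1 out); rewrite outr outl.
exists (fun m => mkseq (w m).2 (w m).1.1.+1), (fun m => (w m).1.2); split.
  move=> m; have [orb endm] := w_orbit m.
  have <- : (w m).2 0%N = src m.
    by apply: (@lshift_inj n k); rewrite -(orb 0%N) // -ur.
  have <- : (w m).2 (w m).1.1 = dst (w m).1.2.
    by apply: ulr; rewrite -orb // -endm.
  apply: dipath_mkseq => [i iN|i j iN jN /f_inj[] //].
  apply: ull; first by rewrite -(orb i) 1?ltnW // -(orb i.+1).
  by apply/eqP => /f_inj[] //; [exact: ltnW|move=> _ /esym/n_Sn].
move=> m m' mm'; apply/pred0P => x; apply/negP => /andP[/= /mapP[i iN ->]].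
case/mapP=> j jN /f_inj[]; [| |by move/eqP: mm'].
- by move: iN; rewrite mem_iota.
- by move: jN; rewrite mem_iota.
Qed.

Lemma dipath_last (T : eqType) (e : rel T) (x y : T) (p : seq T) :
  dipath e x y p -> y \in p.
Proof. by case: p => //= z q /and4P[_ _ /eqP <- _]; apply: mem_last. Qed.

Lemma linking_inj P t : linking P t -> injective t.
Proof.
move=> [path_P disj_P] m m' tm; apply/eqP; apply: contraTT isT.
move=> /disj_P/pred0P/(_ (dst (t m)))/=.
by rewrite (dipath_last (path_P m)) tm (dipath_last (path_P m')).
Qed.

(** Give weight one to the edges of the paths and zero to all others.  A vector
    [(y, z)] in the left kernel has [y = 0] at every source, and [y] keeps its
    value along each path because a node has at most one outgoing edge of
    nonzero weight; off the paths [y] vanishes too, and then so does [z]. *)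
Lemma det_of_linking (F : fieldType) (P : 'I_k -> seq 'I_n) (t : 'I_k -> 'I_k) :
  linking P t ->
  exists2 G : 'M[F]_n, supported E G & \det (bordered G src dst) != 0.
Proof.
move=> link_P; have [path_P disj_P] := link_P.
have [w w_path] : exists w : 'I_k -> nat * (nat -> 'I_n), forall m,
    [/\ (w m).2 0%N = src m, (w m).2 (w m).1 = dst (t m),
        forall i, (i < (w m).1)%N -> ((w m).2 i, (w m).2 i.+1) \in E,
        forall i j, (i <= (w m).1)%N -> (j <= (w m).1)%N ->
          (w m).2 i = (w m).2 j -> i = j &
        P m = mkseq (w m).2 (w m).1.+1].
  apply: (fin_all_exists (P := fun m (w : nat * (nat -> 'I_n)) =>
    [/\ w.2 0%N = src m, w.2 w.1 = dst (t m),
        forall i, (i < w.1)%N -> (w.2 i, w.2 i.+1) \in E,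
        forall i j, (i <= w.1)%N -> (j <= w.1)%N -> w.2 i = w.2 j -> i = j &
        P m = mkseq w.2 w.1.+1])) => m; have [N [f hf]] := dipathP (path_P m).
  by exists (N, f).
have memP m i : (i <= (w m).1)%N -> (w m).2 i \in P m.
  case: (w_path m) => _ _ _ _ -> iN.
  by apply: map_f; rewrite mem_iota.
have f_inj m m' i j : (i <= (w m).1)%N -> (j <= (w m').1)%N ->
    (w m).2 i = (w m').2 j -> m = m' /\ i = j.
  move=> iN jN fE; have mm' : m = m'.
    apply/eqP; apply: contraTT isT => /disj_P/pred0P/(_ ((w m).2 i))/=.
    by rewrite memP // fE memP.
  split=> //; rewrite -mm' in fE jN; case: (w_path m) => _ _ _ inj _.
  exact: inj.
have [t' tK t'K] := injF_bij (linking_inj link_P).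
have dstE l : dst l = (w (t' l)).2 (w (t' l)).1.
  by case: (w_path (t' l)) => _ -> _ _ _; rewrite t'K.
have dst_inj : injective dst.
  move=> l l'; rewrite !dstE => /f_inj[] // /(congr1 t).
  by rewrite !t'K.
pose step j i := [exists m, [exists p : 'I_(w m).1,
  (j == (w m).2 p) && (i == (w m).2 p.+1)]].
pose G : 'M[F]_n := \matrix_(i, j) (step j i)%:R.
exists G => [i j jiE|].
  rewrite mxE; case: (boolP (step j i)) =>
    // /existsP[m /existsP[p /andP[/eqP jp /eqP ip]]].
  by case: (w_path m) => _ _ /(_ p) /=; rewrite -jp -ip (negbTE jiE) ltn_ord => /(_ isT).
apply/det0P => -[v v0].
have [y [z vE]] : exists y z, v = row_mx y z.
  by exists (lsubmx v), (rsubmx v); rewrite hsubmxK.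
rewrite {v}vE in v0 * => vM.
have {vM} [yz_eq y_src] : y *m (1%:M - G) + z *m (\matrix_(l, j) (dst l == j)%:R) = 0 /\
    y *m (\matrix_(i, l) (i == src l)%:R) = 0.
  move: vM; rewrite /bordered mul_row_block mulmx0 addr0 -row_mx0.
  by move/eq_row_mx.
have y_src0 m : y 0 (src m) = 0.
  move/rowP: y_src => /(_ m); rewrite !mxE (bigD1 (src m)) //= mxE eqxx mulr1.
  by rewrite big1 ?addr0 // => i /negbTE im; rewrite mxE im mulr0.
have balance j : y 0 j - \sum_i y 0 i * (step j i)%:R +
    \sum_l z 0 l * (dst l == j)%:R = 0.
  move/rowP: yz_eq => /(_ j); rewrite mulmxBr mulmx1 !mxE => e; rewrite -[RHS]e.
  by congr (_ - _ + _); apply: eq_bigr => i _; rewrite mxE.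
have y_path m p : (p <= (w m).1)%N -> y 0 ((w m).2 p) = 0.
  elim: p => [|p IHp] pN; first by case: (w_path m) => -> _ _ _ _.
  have := balance ((w m).2 p); rewrite IHp ?(ltnW pN) //.
  rewrite [X in _ + X]big1 => [|l _]; last first.
    case: eqP => [|_]; rewrite ?mulr0 // dstE => /f_inj[] //; first exact: ltnW.
    by move=> tm pE; rewrite -tm pE ltnn in pN.
  rewrite (bigD1 ((w m).2 p.+1)) //= big1 => [|i ip].
    have -> : step ((w m).2 p) ((w m).2 p.+1).
      by apply/existsP; exists m; apply/existsP; exists (Ordinal pN); rewrite !eqxx.
    by rewrite mulr1 !addr0 sub0r => /eqP; rewrite oppr_eq0 => /eqP.
  case: (boolP (step _ i)) => [|_]; rewrite ?mulr0 // =>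
    /existsP[m' /existsP[p' /andP[/eqP e /eqP i_e]]].
  have [||mm' pp'] := f_inj m m' p p' _ _ e; [exact: ltnW|exact: ltnW|].
  by case/eqP: ip; rewrite i_e mm' pp'.
have y0 j : y 0 j = 0.
  have [/existsP[m jm]|] := boolP [exists m, j \in P m].
    move: jm; case: (w_path m) => _ _ _ _ -> /mapP[p]; rewrite mem_iota => pN ->.
    exact: y_path.
  rewrite negb_exists => /forallP joff; have := balance j.
  rewrite big1 => [|i _]; last first.
    case: (boolP (step _ i)) => [|_]; rewrite ?mulr0 // =>
      /existsP[m /existsP[p /andP[/eqP e _]]].
    by move: (joff m); rewrite e memP // ltnW.
  rewrite [X in _ + X]big1 ?subr0 ?addr0 // => l _.
  case: eqP => [e|_]; rewrite ?mulr0 //.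
  by move: (joff (t' l)); rewrite -e dstE memP.
have z0 l : z 0 l = 0.
  have := balance (dst l); rewrite y0 big1 => [|i _]; last by rewrite y0 mul0r.
  rewrite subr0 add0r (bigD1 l) //= eqxx mulr1 big1 ?addr0 // => l' l'l.
  by rewrite (inj_eq dst_inj) (negbTE l'l) mulr0.
case/eqP: v0; rewrite -row_mx0; congr row_mx; apply/rowP => i.
  by rewrite y0 mxE.
by rewrite z0 mxE.
Qed.

End Linking.

(** * Paths between edges and selected nodes *)

Section Transfer.

Variables (F : fieldType) (n : nat) (E : {set edge n}) (G : 'M[F]_n).
Hypotheses (supG : supported E G) (wpG : well_posed G).

Lemma linking_of_minor (k : nat) (src dst : 'I_k -> 'I_n) :
  \det (\matrix_(l, m) transfer G (dst l) (src m)) != 0 ->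
  exists P t, linking E src dst P t.
Proof. by rewrite -det_bordered_eq0 //; apply: linking_of_det. Qed.

Lemma transfer_connect (b j : 'I_n) :
  transfer G j b != 0 -> connect (edge_rel E) b j.
Proof.
move=> Tjb; have := @linking_of_minor 1 (fun=> b) (fun=> j).
rewrite det_mx11 mxE => /(_ Tjb) [P [t [path_P _]]].
have := path_P ord0; case: (P ord0) => //= z q /and4P[/eqP -> path_q /eqP <- _].
by apply/connectP; exists q.
Qed.

End Transfer.

(** Turns paths numbered by the rows of a minor into paths indexed by edges. *)
Lemma extend_along (A : finType) (k : nat) (e : 'I_k -> A) (T : Type) (d : T)
    (P : 'I_k -> T) :
  injective e -> exists Q : A -> T, forall j, Q (e j) = P j.
Proof.
move=> e_inj; exists (fun a => if [pick j | e j == a] is Some j then P j else d).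
by move=> j; case: pickP => [j' /eqP/e_inj -> //|/(_ j)]; rewrite eqxx.
Qed.

Lemma sig_enumeration (n : nat) (Cs : {set 'I_n}) :
  bijective (enum_val \o cast_ord (esym (card_sig (mem Cs)))
    : 'I_#|Cs| -> {c | c \in Cs}).
Proof.
apply: inj_card_bij; last by rewrite card_sig card_ord.
by move=> i j /= /enum_val_inj /cast_ord_inj.
Qed.

Section DisjointPaths.

Variables (n : nat) (Cs : {set 'I_n}) (E0 ED : {set edge n}).
Variable (A : {set {a : edge n | a \in ED}}).
Hypothesis cardA : #|A| = #|Cs|.
Let E := E0 :|: ED.

Lemma free_columns_paths_to (F : fieldType) (G : 'M[F]_n) :
    supported E G -> well_posed G ->
    free_columns (fun (c : {c | c \in Cs}) a =>
      transfer G (val c) (end_node (val a))) A ->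
  disjoint_paths_to_measurements Cs E0 A.
Proof.
move=> supG wpG; have [e e_inj eA] := enumeration cardA.
move/(free_columnsP _ (sig_enumeration Cs) e_inj eA).
set r := _ \o _ => /(linking_of_minor supG wpG) [P [t [path_P disj_P]]].
have [Q Qe] := extend_along [::] P e_inj.
exists Q; rewrite -eA; split=> [_ /imsetP[j _ ->]|_ _ /imsetP[j _ ->] /imsetP[j' _ ->]].
  by exists (val (r (t j))); [exact: valP|rewrite Qe; apply: path_P].
by rewrite !Qe (inj_eq e_inj) => /disj_P.
Qed.

Lemma linking_of_paths_to : disjoint_paths_to_measurements Cs E0 A ->
  exists (e : 'I_#|Cs| -> {a : edge n | a \in ED}) P t,
    [/\ injective e, [set e i | i : 'I_#|Cs|] = A &
     linking E (fun j => end_node (val (e j)))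
      (fun i => val ((enum_val \o cast_ord (esym (card_sig (mem Cs)))) i)) P t].
Proof.
have [e e_inj eA] := enumeration cardA.
have [r' _ rK] := sig_enumeration Cs.
move=> [P [path_P disj_P]].
have [t t_path] : exists t : 'I_#|Cs| -> 'I_#|Cs|, forall j,
    dipath (edge_rel E) (end_node (val (e j)))
      (val ((enum_val \o cast_ord (esym (card_sig (mem Cs)))) (t j))) (P (e j)).
  apply: (fin_all_exists (P := fun j tj => dipath (edge_rel E) (end_node (val (e j)))
      (val ((enum_val \o cast_ord (esym (card_sig (mem Cs)))) tj)) (P (e j)))) => j.
  have [|c cC Pc] := path_P (e j); first by rewrite -eA imset_f.
  by exists (r' (exist _ c cC)); rewrite rK.
exists e, (P \o e), t; split=> //; split=> [//|m m' mm'].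
by apply: disj_P; rewrite -?eA ?imset_f // (inj_eq e_inj).
Qed.

End DisjointPaths.

(** The edges are here the destinations, while a linking numbers its paths by
    sources: the minor is transposed and the paths renumbered. *)
Lemma free_columns_paths_from (n : nat) (Bs : {set 'I_n}) (E0 ED : {set edge n})
    (A : {set {a : edge n | a \in ED}}) (F : fieldType) (G : 'M[F]_n) :
    #|A| = #|Bs| -> supported (E0 :|: ED) G -> well_posed G ->
    free_columns (fun (b : {b | b \in Bs}) a =>
      transfer G (start_node (val a)) (val b)) A ->
  disjoint_paths_from_excitations Bs E0 A.
Proof.
move=> cardA supG wpG; have [e e_inj eA] := enumeration cardA.
move/(free_columnsP _ (sig_enumeration Bs) e_inj eA).
set r := _ \o _; rewrite -det_tr.
set M := (_^T)%R; have {M} -> : M =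
    \matrix_(l, m) transfer G (start_node (val (e l))) (val (r m)).
  by apply/matrixP => l m; rewrite !mxE.
move=> /(linking_of_minor supG wpG (src := fun m => val (r m))
  (dst := fun l => start_node (val (e l)))) [P [t link_P]].
have [t' tK t'K] := injF_bij (linking_inj link_P).
have [path_P disj_P] := link_P.
have [Q Qe] := extend_along [::] (P \o t') e_inj.
exists Q; rewrite -eA; split=> [_ /imsetP[j _ ->]|_ _ /imsetP[j _ ->] /imsetP[j' _ ->]].
  exists (val (r (t' j))); first exact: valP.
  by rewrite Qe /=; have := path_P (t' j); rewrite t'K.
rewrite !Qe /= (inj_eq e_inj) => jj'; apply: disj_P.
by rewrite (inj_eq (can_inj t'K)).
Qed.

(** * Paths in the decoupled graph *)

Lemma mem_zip_behead (T : eqType) (x y : T) (p : seq T) :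
  (x, y) \in zip p (behead p) <-> exists p1 p2, p = p1 ++ x :: y :: p2.
Proof.
split=> [|[p1 [p2 ->]]].
  elim: p => // z [|w p] IHp //=; rewrite in_cons => /predU1P[[-> ->]|/IHp].
    by exists [::], p.
  by move=> [p1 [p2 ->]]; exists (z :: p1), p2.
elim: p1 => [|z [|w p1] IHp] //=; first by rewrite mem_head.
  by rewrite !in_cons eqxx orbT.
by rewrite in_cons IHp orbT.
Qed.

Section DecoupledPaths.

Variables (n : nat) (E ED : {set edge n}).
Let dec := decoupled_rel E ED.

Lemma decoupled_path_right (y : 'I_n) (q : seq ('I_n + 'I_n)) :
  path dec (inr y) q ->
  exists2 c, last (inr y) q = inr c & connect (edge_rel E) y c.
Proof.
elim: q y => [|[z|z] q IHq] y //=; first by exists y.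
case/andP=> yz /IHq[c -> zc]; exists c => //.
by apply: connect_trans zc; apply: connect1.
Qed.

Lemma decoupled_path_left (b j : 'I_n) (q : seq ('I_n + 'I_n)) :
  path dec (inl b) q -> last (inl b) q = inl j -> connect (edge_rel E) b j.
Proof.
elim: q b => [|[z|z] q IHq] b /=; first by move=> _ [->].
  by case/andP=> bz /IHq h /h; apply: connect_trans; apply: connect1.
by case/andP=> _ /decoupled_path_right[c ->].
Qed.

(** The decoupled graph has no edge from the right copy to the left one, so a path
    splits at the only unknown edge that it uses to change copies.  Conversely
    the two halves lie in different copies and together repeat no vertex. *)
Lemma connected_through (b c st en : 'I_n) : (st, en) \in ED ->
  (exists2 p, dipath dec (inl b) (inr c) p &
     (inl st, inr en) \in zip p (behead p)) <->
  connect (edge_rel E) b st /\ connect (edge_rel E) en c.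
Proof.
move=> inED; split=> [[p path_p /mem_zip_behead[p1 [p2 pE]]]|[]].
  have [q [qE path_q last_q]] : exists q, [/\ p = inl b :: q,
      path dec (inl b) q & last (inl b) q = inr c].
    case: p path_p {pE} => //= z q /and4P[/eqP -> path_q /eqP last_q _].
    by exists q.
  have [q1 q1E] : exists q1, rcons p1 (inl st) = inl b :: q1.
    move: pE; rewrite qE; case: p1 => [[-> _]|z p1 [-> _]]; first by exists [::].
    by exists (rcons p1 (inl st)).
  have lq1 : last (inl b) q1 = inl st.
    by rewrite -[LHS](last_cons (inl b)) -q1E last_rcons.
  have {pE q1E} qE' : q = q1 ++ inr en :: p2.
    by move: pE; rewrite qE -cat_rcons q1E => -[].
  move: path_q last_q; rewrite qE' cat_path last_cat lq1 /= => /and3P[path1 _ path2] last2.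
  split; first exact: decoupled_path_left path1 lq1.
  by have [c' ] := decoupled_path_right path2; rewrite last2 => -[->].
move=> /connectP[q0 /shortenP[q1 path1 uniq1 _] lq1].
move=> /connectP[q3 /shortenP[q2 path2 uniq2 _] lq2].
exists (map inl (b :: q1) ++ map inr (en :: q2)); last first.
  apply/mem_zip_behead; exists (map inl (belast b q1)), (map inr q2).
  by rewrite lastI -lq1 map_rcons cat_rcons.
rewrite /dipath /= eqxx cat_path last_cat /= last_map -lq1 [dec _ _]inED /=.
rewrite !path_map last_map -lq2 eqxx path1 path2 /=.
rewrite -/(map inl (b :: q1)) -[_ && _]/(uniq (map inl (b :: q1) ++ map inr (en :: q2))).
rewrite cat_uniq !map_inj_uniq ?uniq1 ?uniq2; try by move=> ? ? [].
rewrite andbT -all_predC; apply/allP => _ /mapP[y _ ->].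
by apply/negP => /mapP[].
Qed.

End DecoupledPaths.

(** * Polynomial dependence on the free entries *)

Section Networks.

Variables (n : nat) (E0 ED : {set edge n}).
Let E := E0 :|: ED.

Lemma supported_edges_mx (F : nmodType) (D : {set edge n})
    (v : {a : edge n | a \in D} -> F) : supported D (edges_mx v).
Proof. by move=> i j ji; rewrite mxE insubN. Qed.

Lemma edges_mx_supported (F : nmodType) (D : {set edge n}) (M : 'M[F]_n) :
  supported D M ->
  M = edges_mx (fun a : {a : edge n | a \in D} =>
    M (end_node (val a)) (start_node (val a))).
Proof.
move=> supM; apply/matrixP => i j; rewrite mxE.
by case: insubP => [a _ /= ->|/supM].
Qed.

Lemma supported_addmx (F : nmodType) (D1 D2 : {set edge n}) (M1 M2 : 'M[F]_n) :
  supported D1 M1 -> supported D2 M2 -> supported (D1 :|: D2) (M1 + M2).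
Proof.
move=> sup1 sup2 i j; rewrite inE negb_or mxE => /andP[/sup1 -> /sup2 ->].
by rewrite addr0.
Qed.

(** The shared known entries do not prevent [G] and [G'] from being the same
    arbitrary network, because the two copies of the unknown entries may be
    given equal values. *)
Lemma network_onto (F : nmodType) (M : 'M[F]_n) : [disjoint E0 & ED] ->
  supported E M ->
  exists x : parameter E0 ED -> F, network_G x = M /\ network_G' x = M.
Proof.
move=> disjE supM.
pose entry (a : edge n) := M (end_node a) (start_node a).
exists (fun p => match p with
  | inl a => entry (val a)
  | inr (inl a) => entry (val a)
  | inr (inr a) => entry (val a)
  end).
suff sumE : edges_mx (fun a : {a | a \in E0} => entry (val a)) +
    edges_mx (fun a : {a | a \in ED} => entry (val a)) = M by [].
apply/matrixP => i j; rewrite !mxE.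
case: insubP => [a a0 /= ->|n0]; case: insubP => [a' aD /= |nD].
- by rewrite (disjointFr disjE a0) in aD.
- by rewrite addr0.
- by move=> ->; rewrite add0r.
- by rewrite addr0 supM // inE negb_or n0.
Qed.

Lemma polynomial_edges_mx (F : comNzRingType) (I : finType) (D : {set edge n})
    (c : {a : edge n | a \in D} -> I) i j :
  polynomial_fun (fun x : I -> F => edges_mx (fun a => x (c a)) i j).
Proof.
have [a ja|ja] := @insubP _ _ {a | a \in D} (j, i); [move=> aE|].
  apply: polynomial_fun_ext (polynomial_fun_coord F (c a)) => x.
  by rewrite mxE -aE valK.
by apply: polynomial_fun_ext (polynomial_fun_const I 0) => x; rewrite mxE insubN.
Qed.

Lemma polynomial_network (F : comNzRingType) i j :
  polynomial_fun (fun x : parameter E0 ED -> F => network_G x i j) /\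
  polynomial_fun (fun x : parameter E0 ED -> F => network_G' x i j).
Proof.
by split; apply: polynomial_fun_ext (polynomial_funD
  (polynomial_edges_mx _ _ _ _) (polynomial_edges_mx _ _ _ _)) => x; rewrite [RHS]mxE.
Qed.

End Networks.

(** Well-posedness stays a premise because the polynomial is the determinant of
    the bordered matrix, which controls the minor only where [1 - G] is
    invertible. *)
Lemma generic_minor (F : fieldType) (I : finType) (n k : nat) (E : {set edge n})
    (net : (I -> F) -> 'M[F]_n) (src dst : 'I_k -> 'I_n) P t :
    (forall i j, polynomial_fun (fun x => net x i j)) ->
    (forall M, supported E M -> exists x, net x = M) ->
    linking E src dst P t ->
  generically (fun x => well_posed (net x) ->
    \det (\matrix_(l, m) transfer (net x) (dst l) (src m)) != 0).
Proof.
move=> poly_net net_onto /(det_of_linking F)[M /net_onto[x0 <-] det0].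
have poly_det : polynomial_fun (fun x => \det (bordered (net x) src dst)).
  apply: polynomial_fun_det => i j.
  case: (split_ordP i) => i' ->; case: (split_ordP j) => j' ->.
  - apply: polynomial_fun_ext (polynomial_funD
      (polynomial_fun_const I ((1%:M : 'M[F]_n) i' j'))
      (polynomial_funN (poly_net i' j'))) => x.
    by rewrite block_mxEul !mxE.
  - apply: polynomial_fun_ext (polynomial_fun_const I (i' == src j')%:R) => x.
    by rewrite block_mxEur mxE.
  - apply: polynomial_fun_ext (polynomial_fun_const I (dst i' == j')%:R) => x.
    by rewrite block_mxEdl mxE.
  - apply: polynomial_fun_ext (polynomial_fun_const I 0) => x.
    by rewrite block_mxEdr mxE.
apply: generically_imply (generically_neq0 poly_det det0) => x det_x wp.
by rewrite -det_bordered_eq0.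
Qed.

(** * Assignations as terms of the expansion *)

Section Assignations.

Variables (n : nat) (Bs Cs : {set 'I_n}) (E0 ED : {set edge n}).
Let E := E0 :|: ED.
Let A : finType := {a : edge n | a \in ED}.
Let B : finType := {b : 'I_n | b \in Bs}.
Let C : finType := {c : 'I_n | c \in Cs}.

Definition excitation_admissible (s : {ffun A -> B}) : Prop :=
  [/\ forall b, #|fiber s b| = #|Cs|,
      forall a, connect (edge_rel E) (val (s a)) (start_node (val a)) &
      forall b, disjoint_paths_to_measurements Cs E0 (fiber s b)].

Definition measurement_admissible (s : {ffun A -> C}) : Prop :=
  [/\ forall c, #|fiber s c| = #|Bs|,
      forall a, connect (edge_rel E) (end_node (val a)) (val (s a)) &
      forall c, disjoint_paths_from_excitations Bs E0 (fiber s c)].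

(** Connectedness through [a] is the only clause that involves both maps, and it
    is a conjunction of a path into [a] and a path out of [a]. *)
Lemma admissible_split (s : assignation Bs Cs ED) :
  admissible E0 s <-> excitation_admissible s.1 /\ measurement_admissible s.2.
Proof.
have through a := @connected_through n E ED (val (s.1 a)) (val (s.2 a))
  (start_node (val a)) (end_node (val a)).
have inED (a : A) : (start_node (val a), end_node (val a)) \in ED.
  by rewrite -surjective_pairing; apply: valP.
split=> [[cardB cardC conn toC fromB]|[[cardB connB toC] [cardC connC fromB]]].
  by split; split=> // a; case: ((through a (inED a)).1 (conn a)).
by split=> // a; apply/(through a (inED a)).2.
Qed.

Section Terms.

Variables (F : fieldType) (G G' : 'M[F]_n).

Definition to_measurement (c : C) (a : A) : F :=
  transfer G (val c) (end_node (val a)).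

Definition from_excitation (b : B) (a : A) : F :=
  transfer G' (start_node (val a)) (val b).

Lemma row_product_edges_mx (v : A -> F) k l :
  (measurement_mx F Cs *m transfer G *m edges_mx v *m transfer G' *m
     excitation_mx F Bs) k l =
  \sum_a transfer G (enum_val k) (end_node (val a)) *
         transfer G' (start_node (val a)) (enum_val l) * v a.
Proof.
have -> : edges_mx v = \sum_a v a *: delta_mx (end_node (val a)) (start_node (val a)).
  apply/matrixP => i j; rewrite mxE summxE.
  have [a ja|ja] := @insubP _ _ A (j, i); [move=> aE|].
    rewrite (bigD1 a) //= !mxE aE !eqxx mulr1 big1 ?addr0 // => a' a'a.
    rewrite !mxE; case: eqP => [ie|_]; rewrite ?mulr0 //.
    case: eqP => [je|_]; rewrite ?mulr0 //.
    by case/eqP: a'a; apply: val_inj; rewrite aE [LHS]surjective_pairing ie je.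
  rewrite big1 // => a' _; rewrite !mxE.
  case: eqP => [ie|_]; rewrite ?mulr0 //; case: eqP => [je|_]; rewrite ?mulr0 //.
  by case/negP: ja; rewrite ie je -surjective_pairing; apply: valP.
have left_row i : (measurement_mx F Cs *m transfer G) k i = transfer G (enum_val k) i.
  rewrite mxE (bigD1 (enum_val k)) //= mxE eqxx mul1r big1 ?addr0 // => i' /negbTE ii.
  by rewrite mxE eq_sym ii mul0r.
have right_col j : (transfer G' *m excitation_mx F Bs) j l = transfer G' j (enum_val l).
  rewrite mxE (bigD1 (enum_val l)) //= mxE eqxx mulr1 big1 ?addr0 // => i' /negbTE ii.
  by rewrite mxE ii mulr0.
rewrite mulmx_sumr -mulmxA mulmx_suml summxE; apply: eq_bigr => a _.
rewrite -scalemxAr -scalemxAl mxE [RHS]mulrC; congr (_ * _).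
rewrite mxE (bigD1 (start_node (val a))) //= big1 => [|j /negbTE ja].
  rewrite right_col addr0 mxE (bigD1 (end_node (val a))) //= big1 => [|i /negbTE ia].
    by rewrite left_row addr0 mxE !eqxx mulr1.
  by rewrite [delta_mx _ _ _ _]mxE ia mulr0.
rewrite mxE big1 ?mul0r // => i _.
by rewrite [delta_mx _ _ _ _]mxE ja andbF mulr0.
Qed.

Lemma identifiable_free_columns :
  decoupled_identifiable_at Bs Cs ED G G' <->
  free_columns (row_product to_measurement from_excitation) setT.
Proof.
split=> [ident v v0 a _|free_GG D supD].
  have /matrixP/(_ (end_node (val a)) (start_node (val a))) : edges_mx v = 0.
    apply: ident; first exact: supported_edges_mx.
    apply/matrixP => k l; rewrite row_product_edges_mx mxE.
    rewrite -[RHS](v0 (Sub (enum_val k) (enum_valP k) : C,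
                    Sub (enum_val l) (enum_valP l) : B)).
    by apply: eq_bigl => a'; rewrite inE.
  by rewrite !mxE -surjective_pairing valK.
rewrite (edges_mx_supported supD) => /matrixP D0.
suff v0 (a : A) : D (end_node (val a)) (start_node (val a)) = 0.
  by apply/matrixP => i j; rewrite !mxE; case: insub.
apply: (free_GG (fun a : A => D (end_node (val a)) (start_node (val a)))); last by rewrite inE.
move=> [[c cC] [b bB]].
have := D0 (enum_rank_in cC c) (enum_rank_in bB b).
rewrite row_product_edges_mx !enum_rankK_in // mxE => e; rewrite -[RHS]e.
by apply: eq_bigl => a'; rewrite inE.
Qed.

Hypotheses (supG : supported E G) (wpG : well_posed G).
Hypotheses (supG' : supported E G') (wpG' : well_posed G').
Hypothesis cardED : #|ED| = (#|Bs| * #|Cs|)%N.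

Let cardA : #|A| = (#|B| * #|C|)%N.
Proof. by rewrite !card_sig. Qed.

Lemma nonzero_term_excitation (s : {ffun A -> B}) :
  nonzero_term to_measurement from_excitation s -> excitation_admissible s.
Proof.
move=> [entry_s free_s].
have card_s b : #|fiber s b| = #|Cs|.
  by rewrite (card_fiber cardA free_s) card_sig.
split=> // [a|b]; first exact: transfer_connect (entry_s a).
exact: (free_columns_paths_to (card_s b) supG wpG (free_s b)).
Qed.

Lemma nonzero_term_measurement (s : {ffun A -> C}) :
  nonzero_term from_excitation to_measurement s -> measurement_admissible s.
Proof.
move=> [entry_s free_s].
have cardA' : #|A| = (#|C| * #|B|)%N by rewrite mulnC.
have card_s c : #|fiber s c| = #|Bs|.
  by rewrite (card_fiber cardA' free_s) card_sig.
split=> // [a|c]; first exact: transfer_connect (entry_s a).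
exact: (free_columns_paths_from (card_s c) supG' wpG' (free_s c)).
Qed.

End Terms.

Section Generic.

Variable F : numFieldType.
Hypothesis disjE : [disjoint E0 & ED].
Hypothesis cardED : #|ED| = (#|Bs| * #|Cs|)%N.
Implicit Type x : parameter E0 ED -> F.

Let cardA : #|A| = (#|B| * #|C|)%N.
Proof. by rewrite !card_sig. Qed.

Let supG x : supported E (network_G x).
Proof. by apply: supported_addmx; apply: supported_edges_mx. Qed.

Let supG' x : supported E (network_G' x).
Proof. by apply: supported_addmx; apply: supported_edges_mx. Qed.

(** Both networks can be zero, where [1 - G] has determinant one. *)
Lemma generically_well_posed :
  generically (fun x => well_posed (network_G x) /\ well_posed (network_G' x)).
Proof.
have [x0 [G0 G'0]] : exists x, network_G x = 0 /\ network_G' x = 0.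
  by apply: network_onto => // i j _; rewrite mxE.
have poly_wp (net : (parameter E0 ED -> F) -> 'M[F]_n) :
    (forall i j, polynomial_fun (fun x => net x i j)) ->
  polynomial_fun (fun x => \det (1%:M - net x)).
  move=> poly_net; apply: polynomial_fun_det => i j.
  apply: polynomial_fun_ext (polynomial_funD (polynomial_fun_const _ ((1%:M : 'M[F]_n) i j))
    (polynomial_funN (poly_net i j))) => x.
  by rewrite !mxE.
have wpE (M : 'M[F]_n) : \det (1%:M - M) != 0 -> well_posed M.
  by rewrite /well_posed unitmxE unitfE.
apply: generically_and.
  apply: (generically_imply (fun x => wpE (network_G x))).
  apply: (@generically_neq0 _ _ _ x0); last by rewrite G0 subr0 det1 oner_neq0.
  by apply: poly_wp => i j; case: (polynomial_network E0 ED F i j).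
apply: (generically_imply (fun x => wpE (network_G' x))).
apply: (@generically_neq0 _ _ _ x0); last by rewrite G'0 subr0 det1 oner_neq0.
by apply: poly_wp => i j; case: (polynomial_network E0 ED F i j).
Qed.

Lemma generically_nonzero_term (s : {ffun A -> B}) :
  excitation_admissible s ->
  generically (fun x => well_posed (network_G x) -> well_posed (network_G' x) ->
    nonzero_term (to_measurement (network_G x)) (from_excitation (network_G' x)) s).
Proof.
move=> [card_s conn_s paths_s].
have entries : generically (fun x => forall a, well_posed (network_G' x) ->
    from_excitation (network_G' x) (s a) a != 0).
  apply: generically_all => a.
  have /connectP[q0 /shortenP[q path_q uniq_q _] last_q] := conn_s a.
  have link : @linking n 1 E (fun=> val (s a)) (fun=> start_node (val a))
      (fun=> val (s a) :: q) id.
    split=> [m|m m']; last by rewrite !ord1.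
    by rewrite /dipath eqxx path_q -last_q eqxx.
  apply: generically_imply (generic_minor (net := @network_G' F n E0 ED) _ _ link).
  - by move=> x h /h; rewrite det_mx11 mxE.
  - by move=> i j; case: (polynomial_network E0 ED F i j).
  - by move=> M /(network_onto disjE)[x [_ <-]]; exists x.
have blocks : generically (fun x => forall b, well_posed (network_G x) ->
    free_columns (to_measurement (network_G x)) (fiber s b)).
  apply: generically_all => b.
  have [e [P [t [e_inj eA link]]]] := linking_of_paths_to (card_s b) (paths_s b).
  apply: generically_imply (generic_minor (net := @network_G F n E0 ED) _ _ link).
  - by move=> x h /h det_x; apply/(free_columnsP _ (sig_enumeration Cs) e_inj eA).
  - by move=> i j; case: (polynomial_network E0 ED F i j).
  - by move=> M /(network_onto disjE)[x [<- _]]; exists x.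
apply: generically_imply (generically_and entries blocks) => x [entry_x free_x] wp wp'.
by split=> [a|b]; [apply: entry_x|apply: free_x].
Qed.

(** A single point outside the exceptional set suffices: there the determinant is
    nonzero, hence so is some term of each of the two expansions. *)
Lemma identifiable_admissible :
  generically_decoupled_identifiable F Bs Cs E0 ED ->
  exists s : assignation Bs Cs ED, admissible E0 s.
Proof.
move/lower_dimensional_generically => gen.
have [x [ident_x [wp wp']]] :=
  generically_ex (generically_and gen generically_well_posed).
set X := to_measurement (network_G x); set Y := from_excitation (network_G' x).
have free_XY : free_columns (row_product X Y) setT.
  apply: (free_row_product_stable cardA) => nfree; apply: ident_x; split=> //.
  by move/identifiable_free_columns.
have [sB sB_term] := free_row_product_term cardA free_XY.
have free_YX : free_columns (row_product Y X) setT.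
  move=> v v0; apply: free_XY => -[c b]; rewrite -[RHS](v0 (b, c)).
  by apply: eq_bigr => a _; rewrite /row_product /= [X c a * _]mulrC.
have cardA' : #|A| = (#|C| * #|B|)%N by rewrite mulnC.
have [sC sC_term] := free_row_product_term cardA' free_YX.
exists (sB, sC); apply/admissible_split; split.
  exact: nonzero_term_excitation sB_term.
exact: nonzero_term_measurement sC_term.
Qed.

(** Another map [s'] with a nonzero term at a well-posed point would make
    [(s', sC)] a second admissible assignation. *)
Lemma unique_admissible_identifiable :
  (exists! s : assignation Bs Cs ED, admissible E0 s) ->
  generically_decoupled_identifiable F Bs Cs E0 ED.
Proof.
move=> [[sB sC] [/admissible_split[sB_adm sC_adm] s_uniq]].
apply/lower_dimensional_generically.
apply: generically_imply (generically_nonzero_term sB_adm) => x term_x [wp wp'].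
apply; apply/identifiable_free_columns.
apply: (free_row_product_unique cardA (term_x wp wp')) => s' s'_term.
have s'_adm : admissible E0 ((s', sC) : assignation Bs Cs ED).
  apply/admissible_split; split=> //.
  exact: nonzero_term_excitation s'_term.
by case: (s_uniq _ s'_adm).
Qed.

End Generic.

End Assignations.

Theorem mainTheorem4 (R : realType) (n : nat) (Bs Cs : {set 'I_n})
    (E0 ED : {set edge n}) (disjE : [disjoint E0 & ED])
    (cardED : #|ED| = (#|Bs| * #|Cs|)%N) :
  (generically_decoupled_identifiable R[i] Bs Cs E0 ED ->
     exists s : assignation Bs Cs ED, admissible E0 s) /\
  ((exists! s : assignation Bs Cs ED, admissible E0 s) ->
     generically_decoupled_identifiable R[i] Bs Cs E0 ED).
Proof.
split; first exact: identifiable_admissible.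
exact: unique_admissible_identifiable.
Qed.
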